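(* If $X$ is a perfect Polish space, then $C_{ph}(X)$ is separable.
   Context: For a topological space $X$, $C(X)$ is the set of all continuous functions $f: X\to\mathbb{R}$. For $x\in X$ and $U\subseteq\mathbb{R}$ open, put $[x,U]^{+}=\{f\in C(X): f(x)\in U\}$. For $V\subseteq X$ open and $r\in\mathbb{R}$, put $[V,r]^{-}=\{f\in C(X): f^{-1}(r)\cap V\neq\emptyset\}$. The bi-point-open topology $ph$ on $C(X)$ is the topology having as a subbase all sets of both kinds $[x,U]^{+}$ and $[V,r]^{-}$ (with $x\in X$, $U\subseteq\mathbb{R}$ open, $V\subseteq X$ open, $r\in\mathbb{R}$); $C_{ph}(X)$ denotes $C(X)$ with this topology. A Polish space is a separable completely metrizable space; it is perfect if it has no isolated points. *)

(* Defs.v *)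
From HB Require Import structures.
From mathcomp Require Import all_boot all_order all_algebra.
From mathcomp Require Import all_classical all_reals.
From mathcomp Require Import topology.

Set Implicit Arguments.
Unset Strict Implicit.
Unset Printing Implicit Defensive.

Import Order.TTheory GRing.Theory Num.Theory.
Import numFieldTopology.Exports.

Local Open Scope classical_set_scope.
Local Open Scope ring_scope.

Definition separable (T : topologicalType) : Prop :=
  exists2 D : set T, countable D & dense D.

Definition is_metric (R : realType) (T : Type) (d : T -> T -> R) : Prop :=
  [/\ forall x y, 0 <= d x y,
      forall x y, d x y = 0 <-> x = y,
      forall x y, d x y = d y x
    & forall x y z, d x z <= d x y + d y z].

Definition metric_ball (R : realType) (T : Type) (d : T -> T -> R)
  (x : T) (e : R) : set T := [set y | d x y < e].

(* [d] is existentially quantified over metrics inducing the given topology, so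
   being completely metrizable is a property of the topology alone. *)
Definition completely_metrizable (R : realType) (T : topologicalType) : Prop :=
  exists d : T -> T -> R,
    [/\ is_metric d,
        forall x : T, nbhs x = nbhs_ball_ (metric_ball d) x
      & forall u : nat -> T,
          (forall e : R, 0 < e -> exists N : nat,
             forall m n : nat, (N <= m)%N -> (N <= n)%N -> d (u m) (u n) < e) ->
          exists l : T, u n @[n --> \oo] --> l].

Definition polish_space (R : realType) (T : topologicalType) : Prop :=
  separable T /\ completely_metrizable R T.

Definition perfect_space (T : topologicalType) : Prop :=
  isolated [set: T] = set0.

(* The library attaches several topologies to [continuousType X R] in modules
   that are imported on demand; the alias keeps the bi-point-open topology
   apart from them. *)
Definition C_ph (R : realType) (X : topologicalType) : Type :=
  continuousType X R.

Section bi_point_open.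
Variables (R : realType) (X : topologicalType).

(* [x, U]^+ *)
Definition point_open (x : X) (U : set R) : set (continuousType X R) :=
  [set f | U (f x)].

(* [V, r]^- *)
Definition open_point (V : set X) (r : R) : set (continuousType X R) :=
  [set f | f @^-1` [set r] `&` V !=set0].

Definition ph_subbase : set (set (continuousType X R)) :=
  [set A | exists x (U : set R), open U /\ A = point_open x U] `|`
  [set A | exists (V : set X) r, open V /\ A = open_point V r].

HB.instance Definition _ := Choice.on (C_ph R X).
HB.instance Definition _ :=
  isSubBaseTopological.Build (C_ph R X) ph_subbase id.

End bi_point_open.

(* Main.v *)
Require Import Defs.
From mathcomp Require Import all_boot all_order all_algebra.
From mathcomp Require Import all_classical all_reals.
From mathcomp Require Import topology normedtype.
From mathcomp Require Import lra.

(** Call a finite sum of rational multiples of functions from a fixed countable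
    family a rational combination; there are countably many.  The point is to
    choose the family so that rational combinations meet every nonempty basic
    open set.  A condition [h x \in U] is open in the value, so a rational
    multiple of a bump equal to [1] at [x] meets it.  A condition [h y = r] for
    some [y] in [V] is not: [r] ranges over uncountably many reals, so one
    function has to take a whole interval of values inside [V].  Completeness
    and perfection provide such functions.

    Inside any ball a Cantor scheme of balls can be drawn: every ball contains
    two disjoint smaller ones.  Let a function read off the binary digit [0] or
    [1] according to the half of the scheme it is evaluated in, and sum the
    digits with weights [2^-n].  The partial sums ([stair]) are continuous and
    converge uniformly to a continuous [staircase] that vanishes outside the
    ball.  A number of [[0, 1]] prescribes a branch of the scheme; completeness
    gives a point on the branch, where the staircase takes exactly that value
    ([staircase_onto]).  The countable family consists of the bumps
    ([plateau]) and the staircases around the points of a countable dense set,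
    with radii [2^-k].

    For density, take a function [f0] in a basic open set.  Since [X] is perfect
    the finitely many conditions can be moved to distinct points: the open
    sets [V] are nonempty, hence infinite, so each provides a point not used
    before ([perfect_avoid], [constraints_to_tasks]).  Each condition can then
    be met by one rational multiple of one generator supported in an
    arbitrarily small neighbourhood of its point, and with disjoint supports
    the sum meets all of them ([glue_local_solutions]). *)

Set Implicit Arguments.
Unset Strict Implicit.
Unset Printing Implicit Defensive.

Import Order.TTheory GRing.Theory Num.Theory.
Import numFieldTopology.Exports numFieldNormedType.Exports.

Local Open Scope classical_set_scope.
Local Open Scope ring_scope.

(** * Scalars and perfect spaces *)

Lemma exp2V_lt (R : realType) (eps : R) :
  0 < eps -> exists n, (2 ^+ n)^-1 < eps.
Proof.
move=> e0; exists (Num.bound eps^-1).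
rewrite invf_plt ?posrE ?exprn_gt0//.
apply: lt_trans (archi_boundP _) _; first by rewrite invr_ge0 ltW.
by rewrite -natrX ltr_nat ltn_expl.
Qed.

(** The reason why generators with values [[0, 1]] suffice: rescaling by
    rationals makes them reach any real exactly. *)
Lemma rat_multiple_unit_interval (R : realType) (r : R) :
  exists (q : rat) (t : R), 0 <= t <= 1 /\ ratr q * t = r.
Proof.
have r0 : 0 <= `|r| by [].
have := archi_boundP r0; set n := Num.bound _ => rn.
have n0 : 0 < n%:R :> R by exact: le_lt_trans rn.
have : 0 <= `|r| / n%:R <= 1.
  by rewrite divr_ge0//= ler_pdivrMr// mul1r ltW.
have [r_ge0|r_lt0] := leP 0 r => t01.
  exists n%:R, (`|r| / n%:R); split=> //.
  by rewrite ratr_nat mulrCA divff ?gt_eqF// mulr1 ger0_norm.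
exists (- n%:R), (`|r| / n%:R); split=> //.
rewrite rmorphN/= ratr_nat mulNr mulrCA divff ?gt_eqF// mulr1.
by rewrite ltr0_norm ?opprK.
Qed.

(** By induction on [zs]: removing one closed point [z] from [V] leaves an open
    set, and it is nonempty because [V = [set z]] would isolate [z]. *)
Lemma perfect_avoid (X : topologicalType) (V : set X) (zs : seq X) :
  accessible_space X -> perfect_space X -> open V -> V !=set0 ->
  exists2 y, V y & y \notin zs.
Proof.
move=> X_t1 X_perf; elim: zs V => [|z zs IHzs] V V_open V0.
  by have [y Vy] := V0; exists y.
have [||y [Vy /eqP yz] yzs] := IHzs (V `&` ~` [set z]).
- apply: openI => //; apply: closed_openC.
  exact: (accessible_closed_set1 X_t1).
- apply: contrapT => Vz; have : isolated [set: X] z.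
    split; first by rewrite inE.
    have VE : V = [set z].
      apply/seteqP; split=> [y Vy|_ ->].
        by apply: contrapT => yz; apply: Vz; exists y.
      have [y Vy] := V0; suff <- : y = z by [].
      by apply: contrapT => yz; apply: Vz; exists y.
    exists V; rewrite ?setIT// VE; apply: open_nbhs_nbhs.
    by split=> //; rewrite -VE.
  by rewrite X_perf.
by exists y => //; rewrite inE negb_or yz.
Qed.

(** * Metric spaces *)

Section metric_space.
Context (R : realType) (X : topologicalType) (d : X -> X -> R).
Context (d_metric : is_metric d).
Context (nbhs_d : forall x : X, nbhs x = nbhs_ball_ (metric_ball d) x).

Lemma dist_ge0 x y : 0 <= d x y. Proof. by case: d_metric. Qed.

Lemma dist_refl x : d x x = 0.
Proof. by case: d_metric => _ /(_ x x)[_ ->]. Qed.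

Lemma dist_sym x y : d x y = d y x. Proof. by case: d_metric. Qed.

Lemma dist_triangle y x z : d x z <= d x y + d y z.
Proof. by case: d_metric. Qed.

Lemma dist_gt0 x y : x <> y -> 0 < d x y.
Proof.
move=> xy; rewrite lt_neqAle dist_ge0 andbT eq_sym; apply/eqP => d0.
by apply: xy; case: d_metric => _ /(_ x y)[+ _] _ _; apply.
Qed.

Lemma nbhs_metric_ball x e : 0 < e -> nbhs x (metric_ball d x e).
Proof. by move=> e0; rewrite nbhs_d; exists e. Qed.

Lemma nbhs_metric_ballP x W :
  nbhs x W -> exists2 e, 0 < e & forall y, d x y < e -> W y.
Proof. by rewrite nbhs_d => -[e e0 eW]; exists e. Qed.

Lemma continuous_dist c : continuous (d c).
Proof.
move=> x; apply/cvgrPdist_lt => e e0; near=> y.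
have xy : d x y < e by near: y; exact: nbhs_metric_ball.
have := dist_triangle x c y; have := dist_triangle y c x.
by rewrite (dist_sym y x) ltr_norml; lra.
Unshelve. all: by end_near. Qed.

Lemma metric_hausdorff : hausdorff_space X.
Proof.
move=> x y xy; apply: contrapT => x_neq_y.
have dxy := dist_gt0 x_neq_y.
have e0 : 0 < d x y / 2 by lra.
have [z []] := xy _ _ (nbhs_metric_ball x e0) (nbhs_metric_ball y e0).
rewrite /metric_ball/= (dist_sym y).
have := dist_triangle z x y; lra.
Qed.

Lemma perfect_neighbour (c : X) (e : R) : perfect_space X -> 0 < e ->
  exists c', 0 < d c c' < e.
Proof.
move=> X_perfect e0.
have := nbhs_metric_ball c e0; rewrite nbhsE => -[V [V_open Vc] Ve].
have X_t1 := hausdorff_accessible metric_hausdorff.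
have [|y Vy] := perfect_avoid [:: c] X_t1 X_perfect V_open.
  by exists c.
rewrite inE => /eqP yc; exists y; rewrite dist_gt0 ?Ve//.
by move=> cy; exact: yc.
Qed.

Definition plateau (c : X) (e : R) (x : X) : R :=
  Num.min 1 (Num.max 0 (2 - d c x / e)).

Lemma plateau_ge0 c e x : 0 <= plateau c e x.
Proof. by rewrite /plateau le_min ler01 le_max lexx. Qed.

Lemma plateau_le1 c e x : plateau c e x <= 1.
Proof. by rewrite /plateau ge_min lexx. Qed.

Lemma plateau1 c e x : 0 < e -> d c x <= e -> plateau c e x = 1.
Proof.
move=> e0 cx; apply/min_idPl; rewrite le_max; apply/orP; right.
have : d c x / e <= 1 by rewrite ler_pdivrMr// mul1r.
lra.
Qed.

Lemma plateau0 c e x : 0 < e -> 2 * e <= d c x -> plateau c e x = 0.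
Proof.
move=> e0 cx; rewrite /plateau (_ : Num.max _ _ = 0) ?min_r//.
by apply/max_idPl; rewrite subr_le0 ler_pdivlMr.
Qed.

Lemma continuous_plateau c e : continuous (plateau c e).
Proof.
apply: min_fun_continuous; first exact: cst_continuous.
apply: max_fun_continuous; first exact: cst_continuous.
move=> x; apply: cvgB; first exact: cvg_cst.
by apply: cvgMl; exact: continuous_dist.
Qed.

(** * The staircase of a Cantor scheme *)

Section staircase.
Context (sib : X -> R -> X).
Context (sibP : forall (c : X) (e : R), 0 < e -> 0 < d c (sib c e) < e / 2).

(** A third of the distance between [c] and its neighbour, so that the closed
    balls of radius [rad c e] around both are disjoint, with room for the slope
    of a [plateau] between them; both lie in the ball of radius [e] around
    [c]. *)
Definition rad (c : X) (e : R) : R := d c (sib c e) / 3.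

Lemma rad_gt0 c e : 0 < e -> 0 < rad c e.
Proof. by move=> /(sibP c)/andP[+ _]; rewrite /rad => ?; lra. Qed.

Lemma rad_lt c e : 0 < e -> 6 * rad c e < e.
Proof. by move=> /(sibP c)/andP[_]; rewrite /rad => ?; lra. Qed.

Lemma dist_sib c e : d c (sib c e) = 3 * rad c e.
Proof. by rewrite /rad; lra. Qed.

(** The plateau is the first binary digit: [1] on the ball around [sib c e], [0]
    on the ball around [c].  The two recursive terms have disjoint supports and
    contribute the next [n - 1] digits. *)
Fixpoint stair n c e x : R :=
  if n is m.+1 then
    (plateau (sib c e) (rad c e) x + stair m c (rad c e) x
     + stair m (sib c e) (rad c e) x) / 2
  else 0.

(** Everything added at a node lives in its open ball: [sib c e] is at distance
    less than [e / 2] from [c], and [2 * rad c e < e / 3]. *)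
Lemma stair_supp n c e x : 0 < e -> e <= d c x -> stair n c e x = 0.
Proof.
elim: n c e => [//|n IHn] c e e0 cx /=.
have := rad_gt0 c e0; have := rad_lt c e0; have := dist_sib c e.
have := dist_triangle (sib c e) c x => t1 t2 t3 t4.
rewrite plateau0 ?IHn ?addr0 ?mul0r//; lra.
Qed.

(** Passing from [n] to [n + 1] steps changes only the two recursive terms; at
    most one of them is nonzero at [x], so the increment is halved at each
    level. *)
Lemma stair_step n c e x : 0 < e ->
  0 <= stair n.+1 c e x - stair n c e x <= (2 ^+ n.+1)^-1.
Proof.
elim: n c e => [|n IHn] c e e0.
  rewrite /= addr0 addr0 subr0 expr1.
  by have := plateau_ge0 (sib c e) (rad c e) x;
    have := plateau_le1 (sib c e) (rad c e) x; lra.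
have r0 := rad_gt0 c e0.
rewrite exprS invfM.
have /andP[a0 a1] := IHn c _ r0.
have /andP[b0 b1] := IHn (sib c e) _ r0.
have [cx|cx] := leP (rad c e) (d c x).
  rewrite [stair n.+2 _ _ _]/= -/(stair n.+1 c _ x) -/(stair n.+1 _ _ x).
  rewrite [stair n.+1 c e x]/= (stair_supp n.+1)// (stair_supp n (c := c))//.
  by lra.
have sx : rad c e <= d (sib c e) x.
  have := dist_triangle x c (sib c e); rewrite dist_sib (dist_sym x); lra.
rewrite [stair n.+2 _ _ _]/= -/(stair n.+1 c _ x) -/(stair n.+1 _ _ x).
rewrite [stair n.+1 c e x]/= (stair_supp n.+1 (c := sib c e))//.
by rewrite (stair_supp n (c := sib c e))//; lra.
Qed.

Lemma continuous_stair n c e : continuous (stair n c e).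
Proof.
elim: n c e => [|n IHn] c e x /=; first exact: cvg_cst.
by apply: cvgMl; apply: cvgD; [apply: cvgD; [exact: continuous_plateau|]|];
  exact: IHn.
Qed.

Definition staircase c e x : R := sup (range (fun n => stair n c e x)).

(** The subtracted last term is what makes the geometric bound inductive. *)
Lemma stair_le_add n m c e x : 0 < e ->
  stair n c e x <= stair (n + m) c e x <=
    stair n c e x + (2 ^+ n)^-1 - (2 ^+ (n + m))^-1.
Proof.
move=> e0; elim: m => [|m IHm]; first by rewrite addn0; lra.
have := stair_step (n + m) c x e0.
rewrite addnS exprS invfM; lra.
Qed.

Lemma staircase_approx n c e x : 0 < e ->
  stair n c e x <= staircase c e x <= stair n c e x + (2 ^+ n)^-1.
Proof.
move=> e0.
have ub : ubound (range (fun n => stair n c e x)) (stair n c e x + (2 ^+ n)^-1).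
  move=> _ [m _ <-]; have [nm|/ltnW mn] := leqP n m.
    have := stair_le_add n (m - n) c x e0; rewrite subnKC//.
    have : 0 < (2 ^+ m)^-1 :> R by rewrite invr_gt0 exprn_gt0.
    by lra.
  have := stair_le_add m (n - m) c x e0; rewrite subnKC//.
  have : 0 < (2 ^+ n)^-1 :> R by rewrite invr_gt0 exprn_gt0.
  by lra.
apply/andP; split.
  by apply: ub_le_sup; [exists (stair n c e x + (2 ^+ n)^-1)|exists n].
by apply: ge_sup => //; exists (stair 0 c e x); exists 0%N.
Qed.

Lemma staircase_supp c e x : 0 < e -> e <= d c x -> staircase c e x = 0.
Proof.
move=> e0 cx; rewrite /staircase.
suff -> : range (fun n => stair n c e x) = [set 0] by exact: sup1.
apply/seteqP; split => [_ [n _ <-]|_ ->]; last by exists 0%N.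
exact: stair_supp.
Qed.

Lemma continuous_staircase c e : 0 < e -> continuous (staircase c e).
Proof.
move=> e0 x; apply/cvgrPdist_lt => eps eps0.
have [n n_eps] : exists n, (2 ^+ n)^-1 < eps / 2 by apply: exp2V_lt; lra.
near=> y.
have : `|stair n c e x - stair n c e y| < eps / 2.
  by near: y; move/cvgrPdist_lt: (@continuous_stair n c e x); apply; lra.
have := staircase_approx n c x e0; have := staircase_approx n c y e0.
by rewrite !ltr_norml; lra.
Unshelve. all: by end_near. Qed.

(** A state [(c, e, r)] is a node of the scheme together with a number whose
    binary expansion is still to be followed: the step consumes its first
    digit. *)
Definition branch_next (s : X * R * R) : X * R * R :=
  let: (c, e, r) := s in
  if r < 2^-1 then (c, rad c e, 2 * r) else (sib c e, rad c e, 2 * r - 1).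

Definition branch_inv (s : X * R * R) : bool := (0 < s.1.2) && (0 <= s.2 <= 1).

Definition in_node (s : X * R * R) (x : X) : bool := d s.1.1 x <= s.1.2.

Lemma branch_nextP s : branch_inv s ->
  [/\ branch_inv (branch_next s), (branch_next s).1.2 <= s.1.2 / 2 &
      forall x, in_node (branch_next s) x -> in_node s x].
Proof.
move: s => [[c e] r]; rewrite /branch_inv/= => /andP[e0 r01].
have r0 := rad_gt0 c e0; have re := rad_lt c e0.
rewrite /branch_inv /in_node.
case: (ltP r 2^-1) => ? /=; split; [by rewrite r0/=; lra|by lra| |
                           by rewrite r0/=; lra|by lra|] => x; first by lra.
have := dist_triangle (sib c e) c x; rewrite dist_sib; lra.
Qed.

Lemma branch_iterP n s : branch_inv s -> branch_inv (iter n branch_next s).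
Proof. by move=> s_inv; elim: n => //= n /branch_nextP[]. Qed.

Lemma branch_radius n s : branch_inv s ->
  (iter n branch_next s).1.2 <= s.1.2 / 2 ^+ n.
Proof.
move=> s_inv; elim: n => [|n IHn]; first by rewrite expr0 divr1.
have [_ + _] := branch_nextP (branch_iterP n s_inv).
rewrite /= exprSr invfM mulrA; lra.
Qed.

Lemma branch_nested n m s x : branch_inv s -> (n <= m)%N ->
  in_node (iter m branch_next s) x -> in_node (iter n branch_next s) x.
Proof.
move=> s_inv /subnKC <-; elim: (m - n)%N => [|k IHk]; first by rewrite addn0.
by rewrite addnS /= => xk; apply: IHk;
  have [_ _] := branch_nextP (branch_iterP (n + k) s_inv); apply.
Qed.

(** At a point of the branch coded by [r] the first digit read by [stair] is the
    first digit of [r], and the term of the other child vanishes; the error is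
    half of the one left for the remaining digits. *)
Lemma stair_on_branch n s x : branch_inv s ->
  (forall k, in_node (iter k branch_next s) x) ->
  `|stair n s.1.1 s.1.2 x - s.2| <= (2 ^+ n)^-1.
Proof.
elim: n s => [|n IHn] s s_inv xs.
  by move: s_inv => /andP[_]; rewrite /= expr0 ler_norml; lra.
have [s'_inv _ _] := branch_nextP s_inv.
have {}IHn := IHn _ s'_inv.
have {IHn} : `|stair n (branch_next s).1.1 (branch_next s).1.2 x
               - (branch_next s).2| <= (2 ^+ n)^-1.
  by apply: IHn => k; rewrite -iterSr.
move: {xs}(xs 1%N).
move: s s_inv s'_inv => [[c e] r] /andP[/= e0 r01] _.
have r0 := rad_gt0 c e0.
rewrite exprS invfM /in_node /=.
have := dist_triangle x c (sib c e); rewrite dist_sib (dist_sym x) => tri.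
case: (ltP r 2^-1) => r2 /= cx.
  rewrite plateau0 ?(stair_supp _ (c := sib c e))//; try lra.
  by rewrite !ler_norml; lra.
rewrite plateau1 ?(stair_supp _ (c := c))//; try lra.
by rewrite !ler_norml; lra.
Qed.

Context (d_complete : forall u : nat -> X,
  (forall e : R, 0 < e -> exists N : nat,
     forall m n : nat, (N <= m)%N -> (N <= n)%N -> d (u m) (u n) < e) ->
  exists l : X, u n @[n --> \oo] --> l).

(** The centres of the nodes form a Cauchy sequence; the tail from [n] on stays
    in the closed ball of node [n], hence so does the limit. *)
Lemma branch_point s : branch_inv s ->
  exists x, forall n, in_node (iter n branch_next s) x.
Proof.
move=> s_inv; pose u n := (iter n branch_next s).1.1.
have u_in n m : (n <= m)%N -> in_node (iter n branch_next s) (u m).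
  move=> nm; apply: (branch_nested s_inv nm).
  by rewrite /in_node dist_refl; have /andP[/ltW] := branch_iterP m s_inv.
have [l ul] : exists l : X, u n @[n --> \oo] --> l.
  apply: d_complete => eps eps0.
  have s0 : 0 < s.1.2 by case/andP: s_inv.
  have [N Neps] : exists n, (2 ^+ n)^-1 < eps / 2 / s.1.2.
    by apply: exp2V_lt; rewrite !divr_gt0.
  exists N => m n Nm Nn.
  have := branch_radius N s_inv; have := u_in _ _ Nm; have := u_in _ _ Nn.
  move: Neps; rewrite /in_node ltr_pdivlMr// (mulrC _ s.1.2).
  have := dist_triangle (u N) (u m) (u n); rewrite (dist_sym (u m) (u N)).
  rewrite /u; lra.
exists l => n; rewrite /in_node; apply/ler_addgt0Pr => eps eps0.
have /ul[N _ Nl] := nbhs_metric_ball l eps0.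
have lu : d l (u (maxn n N)) < eps by apply: Nl; rewrite /= leq_maxr.
have := u_in n (maxn n N) (leq_maxl _ _); rewrite /in_node.
have := dist_triangle (u (maxn n N)) (u n) l.
rewrite (dist_sym (u (maxn n N)) l).
rewrite /u in lu *; lra.
Qed.

(** The limit of the digit sums at a point of the branch of [r] is [r]. *)
Lemma staircase_onto c e r : 0 < e -> 0 <= r <= 1 ->
  exists2 x, d c x <= e & staircase c e x = r.
Proof.
move=> e0 r01; have s_inv : branch_inv (c, e, r) by rewrite /branch_inv/= e0.
have [x xs] := branch_point s_inv; exists x; first exact: (xs 0%N).
apply/eqP; rewrite -subr_eq0 -normr_le0; apply/ler_addgt0Pr => eps eps0.
have [n neps] : exists n, (2 ^+ n)^-1 < eps / 2 by apply: exp2V_lt; lra.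
have /= := stair_on_branch n s_inv xs; have := staircase_approx n c x e0.
by rewrite add0r !ler_norml; lra.
Qed.

End staircase.
End metric_space.

(** * Gluing local solutions *)

Section combinations.
Context (R : realType) (X : topologicalType) (I : Type) (g : I -> X -> R).

Definition rat_combo (s : seq (rat * I)) (x : X) : R :=
  \sum_(p <- s) ratr p.1 * g p.2 x.

Lemma continuous_rat_combo s :
  (forall i, continuous (g i)) -> continuous (rat_combo s).
Proof.
move=> g_cont x; elim: s => [|p s IHs].
  rewrite (_ : rat_combo [::] = fun=> 0); first exact: cvg_cst.
  by apply/funext => y; rewrite /rat_combo big_nil.
rewrite (_ : rat_combo (p :: s) = fun y => ratr p.1 * g p.2 y + rat_combo s y).
  by apply: cvgD => //; apply: cvgMr; exact: g_cont.
by apply/funext => y; rewrite /rat_combo big_cons.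
Qed.

(** A task at the point [t.1] asks for a function in [t.2].  It is solvable if a
    rational multiple of a single generator achieves it with arbitrarily small
    support, in such a way that altering the function elsewhere does no harm. *)
Definition locally_solvable (t : X * set (X -> R)) : Prop :=
  forall W, nbhs t.1 W -> exists (q : rat) (i : I),
    (forall x, ~ W x -> g i x = 0) /\
    forall h : X -> R, (forall x, W x -> h x = ratr q * g i x) -> t.2 h.

Section gluing.
Context (d : X -> X -> R) (d_metric : is_metric d).
Context (nbhs_d : forall x : X, nbhs x = nbhs_ball_ (metric_ball d) x).

Lemma separation_radius (zs : seq X) : uniq zs ->
  exists2 e, 0 < e & {in zs &, forall y z, y != z -> 2 * e <= d y z}.
Proof.
move=> zs_uniq; pose S := \sum_(y <- zs) \sum_(z <- zs) (d y z)^-1.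
have term0 y z : 0 <= (d y z)^-1 by rewrite invr_ge0 (dist_ge0 d_metric).
have S0 : 0 <= S by apply: sumr_ge0 => y _; apply: sumr_ge0.
(* Each inverse distance is at most [S]; the summand [1] keeps the radius
   positive when [zs] has no two distinct points. *)
exists (2 * (1 + S))^-1; first by rewrite invr_gt0; lra.
move=> y z yzs zzs /eqP yz.
rewrite invfM mulVKf ?pnatr_eq0// invf_ple ?posrE; last 2 first.
- lra.
- exact: dist_gt0.
have : (d y z)^-1 <= \sum_(z' <- zs) (d y z')^-1.
  by rewrite (bigD1_seq z)//= lerDl sumr_ge0.
have : \sum_(z' <- zs) (d y z')^-1 <= S.
  rewrite /S [leRHS](bigD1_seq y)//= lerDl sumr_ge0// => ? _.
  exact: sumr_ge0.
lra.
Qed.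

(** Solve each task inside a ball around its point, with radii so small that the
    balls are disjoint.  In each ball the sum coincides with the solution chosen
    for that ball. *)
Lemma glue_local_solutions (ts : seq (X * set (X -> R))) :
  uniq [seq t.1 | t <- ts] -> {in ts, forall t, locally_solvable t} ->
  exists s, {in ts, forall t, t.2 (rat_combo s)}.
Proof.
move=> ts_uniq ts_solv.
have [e e0 e_sep] := separation_radius ts_uniq.
(* Strengthened for induction: the combination vanishes off the balls, so that
   the next generator is not disturbed inside its own ball, and each goal is
   met by every function with the right values in its ball, so that generators
   added later do not undo it. *)
suff [s [_ s_ts]] : exists s,
    (forall x, {in ts, forall t, e <= d t.1 x} -> rat_combo s x = 0) /\
    {in ts, forall t, forall h : X -> R,
       (forall x, d t.1 x < e -> h x = rat_combo s x) -> t.2 h}.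
  by exists s => t tts; apply: s_ts.
elim: ts ts_uniq ts_solv e_sep => [|t ts IHts] /=.
  by exists [::]; split => // x _; rewrite /rat_combo big_nil.
move=> /andP[t_ts ts_uniq] ts_solv e_sep.
have [||s [s0 s_ts]] := IHts ts_uniq.
- by move=> u uts; apply: ts_solv; rewrite inE uts orbT.
- by move=> y z yts zts; apply: e_sep; rewrite inE ?yts ?zts orbT.
have [q [i [gi0 gi_t]]] :=
  ts_solv t (mem_head _ _) _ (nbhs_metric_ball nbhs_d t.1 e0).
have sepP (u : X * set (X -> R)) x : u \in ts -> d t.1 x < e -> e <= d u.1 x.
  move=> uts tx; have uts1 : u.1 \in [seq t.1 | t <- ts] by apply: map_f.
  have : 2 * e <= d t.1 u.1.
    apply: e_sep; rewrite ?mem_head// ?inE ?uts1 ?orbT//.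
    by apply: contraNneq t_ts => ->.
  have := dist_triangle d_metric x t.1 u.1.
  rewrite (dist_sym d_metric x u.1); lra.
have comboE x : rat_combo ((q, i) :: s) x = ratr q * g i x + rat_combo s x.
  by rewrite /rat_combo big_cons.
exists ((q, i) :: s); split=> [x x_ts|u].
  have tx : ~ d t.1 x < e by apply/negP; rewrite -leNgt x_ts// mem_head.
  rewrite comboE gi0// mulr0 add0r; apply: s0 => u uts.
  by apply: x_ts; rewrite inE uts orbT.
rewrite inE => /predU1P[->|uts] h hE.
  apply: gi_t => x tx; rewrite hE// comboE s0 ?addr0// => w wts.
  exact: sepP.
apply: (s_ts _ uts) => x ux; rewrite hE// comboE gi0 ?mulr0 ?add0r// => tx.
by have := sepP _ _ uts tx; rewrite leNgt ux.
Qed.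

End gluing.

Section local_tasks.
Context (g_peak : forall (x : X) W, nbhs x W ->
  exists i, g i x = 1 /\ forall y, ~ W y -> g i y = 0).
Context (g_onto : forall (x : X) W, nbhs x W -> exists i,
  (forall r, 0 <= r <= 1 -> exists2 y, W y & g i y = r) /\
  forall y, ~ W y -> g i y = 0).

Lemma solvable_near_value x r e : 0 < e ->
  locally_solvable (x, [set h | `|h x - r| < e]).
Proof.
move=> e0 W xW; have [i [gx gW]] := g_peak xW.
have [q qr] : exists q, ratr q \in `]r - e, r + e[ by apply: rat_in_itvoo; lra.
exists q, i; split => // h hE /=.
rewrite hE ?gx ?mulr1 ?ltr_distl; last exact: nbhs_singleton.
by move: qr; rewrite in_itv.
Qed.

(** A generator supported in [W `&` V] takes all values of [[0, 1]] there, so a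
    rational multiple of it takes the value [r] in [V]. *)
Lemma solvable_attained_value (V : set X) r x : nbhs x V ->
  locally_solvable (x, [set h | exists2 y, V y & h y = r]).
Proof.
move=> xV W xW; have [i [gr gW]] := g_onto (filterI xW xV).
have [q [t [t01 qt]]] := rat_multiple_unit_interval r.
exists q, i; split => [y yW|h hE /=]; first by apply: gW => -[].
have [y [Wy Vy] gy] := gr t t01.
by exists y => //; rewrite hE// gy.
Qed.

(** The points of [xs] are fixed, whereas a condition on an open set may be
    served at any of its points: it is given one that no earlier task uses. *)
Lemma constraints_to_tasks (f0 : X -> R) (xs : seq X) (e : R)
    (vs : seq (set X * R)) : accessible_space X -> perfect_space X ->
  0 < e -> {in vs, forall v, open v.1 /\ v.1 !=set0} ->
  exists ts : seq (X * set (X -> R)),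
    [/\ uniq [seq t.1 | t <- ts], {in ts, forall t, locally_solvable t} &
    forall h : X -> R, {in ts, forall t, t.2 h} ->
      {in xs, forall x, `|h x - f0 x| < e} /\
      {in vs, forall v, exists2 y, v.1 y & h y = v.2}].
Proof.
move=> X_t1 X_perf e0; elim: vs => [|v vs IHvs] vsP.
  exists [seq (x, [set h | `|h x - f0 x| < e]) | x <- undup xs]; split.
  - by rewrite -map_comp (map_id_in (f := _)) ?undup_uniq.
  - by move=> _ /mapP[x _ ->]; exact: solvable_near_value.
  - move=> h hP; split=> // x xxs.
    apply: (hP (x, [set h | `|h x - f0 x| < e])).
    by apply: map_f; rewrite mem_undup.
have [|ts [ts_uniq ts_solv tsP]] := IHvs.
  by move=> u uvs; apply: vsP; rewrite inE uvs orbT.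
have [V_open V0] := vsP v (mem_head _ _).
have [y Vy y_ts] := perfect_avoid [seq t.1 | t <- ts] X_t1 X_perf V_open V0.
exists ((y, [set h | exists2 y, v.1 y & h y = v.2]) :: ts); split.
- by rewrite /= y_ts.
- move=> t; rewrite inE => /predU1P[->|]; last exact: ts_solv.
  by apply: solvable_attained_value; exact: open_nbhs_nbhs.
- move=> h h_ts; have [|h_xs h_vs] := tsP h.
    by move=> t tts; apply: h_ts; rewrite inE tts orbT.
  split=> // u; rewrite inE => /predU1P[->|]; last exact: h_vs.
  exact: (h_ts _ (mem_head _ _)).
Qed.

End local_tasks.
End combinations.

(** * Density in the bi-point-open topology *)

(** Near [f0], finitely many point-open conditions amount to closeness to [f0]
    at finitely many points.  This merges repeated points: the sets [U]
    prescribed at one point have the common element [f0 x]. *)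
Lemma subbasic_constraints (R : realType) (X : topologicalType)
    (f0 : C_ph R X) (As : seq (set (continuousType X R))) :
  {in As, forall A, ph_subbase A /\ A f0} ->
  exists (xs : seq X) (e : R) (vs : seq (set X * R)),
    [/\ 0 < e, {in vs, forall v, open v.1 /\ v.1 !=set0} &
    forall h : continuousType X R,
      {in xs, forall x, `|h x - f0 x| < e} ->
      {in vs, forall v, exists2 y, v.1 y & h y = v.2} ->
      {in As, forall A, A h}].
Proof.
elim: As => [|A As IHAs] AsP; first by exists [::], 1, [::]; split.
have [|xs [e [vs [e0 vsP xsvsP]]]] := IHAs.
  by move=> B BAs; apply: AsP; rewrite inE BAs orbT.
have [[|]] := AsP A (mem_head _ _).
- move=> [x [U [U_open ->]]] Uf0.
  have /nbhs_ballP[e' /= e'0 e'U] : nbhs (f0 x) U by exact: open_nbhs_nbhs.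
  exists (x :: xs), (Num.min e e'), vs; split=> //.
    by rewrite lt_min e0.
  move=> h h_xs h_vs B; rewrite inE => /predU1P[->|BAs].
    apply: e'U; rewrite /ball/= distrC.
    by have := h_xs x (mem_head _ _); rewrite lt_min => /andP[].
  apply: (xsvsP h) => // y yxs.
  by have := h_xs y; rewrite inE yxs orbT lt_min => /(_ isT)/andP[].
- move=> [V [r [V_open ->]]] [y [f0y Vy]].
  exists xs, e, ((V, r) :: vs); split=> //.
    move=> v; rewrite inE => /predU1P[->|]; last exact: vsP.
    by split=> //; exists y.
  move=> h h_xs h_vs B; rewrite inE => /predU1P[->|BAs].
    by have [z Vz hz] := h_vs _ (mem_head _ _); exists z.
  by apply: (xsvsP h) => // v vvs; apply: h_vs; rewrite inE vvs orbT.
Qed.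

Section density.
Context (R : realType) (X : topologicalType) (d : X -> X -> R).
Context (d_metric : is_metric d).
Context (nbhs_d : forall x : X, nbhs x = nbhs_ball_ (metric_ball d) x).
Context (X_perfect : perfect_space X).

(** What the countable family has to provide: small bumps at every point, and
    small functions taking all values of [[0, 1]] near every point. *)
Lemma separable_C_ph_of_generators (I : countType) (g : I -> X -> R) :
  (forall i, continuous (g i)) ->
  (forall (x : X) W, nbhs x W ->
     exists i, g i x = 1 /\ forall y, ~ W y -> g i y = 0) ->
  (forall (x : X) W, nbhs x W -> exists i,
     (forall r, 0 <= r <= 1 -> exists2 y, W y & g i y = r) /\
     forall y, ~ W y -> g i y = 0) ->
  separable (C_ph R X).
Proof.
move=> g_cont g_peak g_onto.
pose D (s : seq (rat * I)) : C_ph R X :=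
  mkcts (continuous_rat_combo (s := s) g_cont) : continuousType X R.
exists (range D).
  by apply: card_le_trans (card_image_le _ _) _; exact: countableP.
move=> O [f0 Of0] [B /= BO O_eq].
move: Of0; rewrite -O_eq => -[A BA Af0].
have [F F_sub FA] := BO _ BA.
have [A' A'F|xs [e [vs [e0 vsP xsvsP]]]] :=
  @subbasic_constraints _ _ f0 (finmap.enum_fset F).
  split; first exact/set_mem/F_sub.
  by move: Af0; rewrite -FA; apply.
have X_t1 := hausdorff_accessible (metric_hausdorff d_metric nbhs_d).
have [ts [ts_uniq ts_solv tsP]] :=
  constraints_to_tasks g_peak g_onto f0 xs X_t1 X_perfect e0 vsP.
have [s s_ts] := glue_local_solutions d_metric nbhs_d ts_uniq ts_solv.
have [s_xs s_vs] := tsP _ s_ts.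
exists (D s); split; last by exists s.
exists A => //; rewrite -FA => E EF.
exact: (xsvsP (D s) s_xs s_vs).
Qed.

End density.

Theorem corollary2p7 (R : realType) (X : topologicalType) :
  polish_space R X -> perfect_space X -> separable (C_ph R X).
Proof.
move=> [[D0 D0_count D0_dense] [d [d_metric nbhs_d d_complete]]] X_perf.
have [sib sibP] : exists sib : X -> R -> X,
    forall (c : X) (e : R), 0 < e -> 0 < d c (sib c e) < e / 2.
  have /choice[sib sibP] : forall p : X * R, exists c',
      0 < p.2 -> 0 < d p.1 c' < p.2 / 2.
    move=> [c e]; have [e0|e0] := ltP 0 e; last by exists c => /=; lra.
    have [|c' c'P] := perfect_neighbour d_metric nbhs_d c X_perf (e := e / 2).
      by lra.
    by exists c'.
  by exists (fun c e => sib (c, e)) => c e; exact: (sibP (c, e)).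
have [D0_0|[p]] := elimT pfcard_geP D0_count.
  (* An empty dense set leaves no point in [X]; any family of generators will
     do, and the combinations reduce to the only function. *)
  have X_empty (x : X) : False.
    have [|y []] := D0_dense setT _ openT; first by exists x.
    by rewrite D0_0.
  by apply: (separable_C_ph_of_generators d_metric nbhs_d X_perf
    (g := fun (_ : void) _ => 0)) => [[]|x|x]; case: (X_empty x).
have small_ball (x : X) W : nbhs x W -> exists n k,
    d (p n) x <= (2 ^+ k)^-1 /\ forall y, d (p n) y < 2 * (2 ^+ k)^-1 -> W y.
  move=> /(nbhs_metric_ballP nbhs_d)[e e0 eW].
  (* [x] is within [2^-k] of the centre, so the ball of radius [2 * 2^-k]
     around the centre is within [3 * 2^-k] of [x]. *)
  have [k ke] : exists k, (2 ^+ k)^-1 < e / 3 :> R by apply: exp2V_lt; lra.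
  have r0 : 0 < (2 ^+ k)^-1 :> R by rewrite invr_gt0 exprn_gt0.
  have := nbhs_metric_ball nbhs_d x r0; rewrite nbhsE => -[V [V_open Vx] Vr].
  have [|c [Vc D0c]] := D0_dense V _ V_open; first by exists x.
  have [n _ pn] := 'surj_p D0c.
  have := Vr _ Vc; rewrite /metric_ball /= => xc.
  exists n, k; rewrite pn (dist_sym d_metric); split; first exact: ltW.
  move=> y cy; apply: eW; have := dist_triangle d_metric c x y; lra.
pose g (i : nat * nat * bool) : X -> R :=
  (if i.2 then plateau d else staircase d sib) (p i.1.1) (2 ^+ i.1.2)^-1.
have r0 k : 0 < (2 ^+ k)^-1 :> R by rewrite invr_gt0 exprn_gt0.
apply: (separable_C_ph_of_generators d_metric nbhs_d X_perf (g := g)).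
- move=> [[n k] []]; rewrite /g/=; first exact: continuous_plateau.
  exact: continuous_staircase.
- move=> x W /small_ball[n [k [nx nW]]]; exists (n, k, true).
  split; first exact: plateau1.
  move=> y Wy; apply: plateau0 => //; rewrite leNgt; apply/negP => ny.
  exact/Wy/nW.
- move=> x W /small_ball[n [k [nx nW]]]; exists (n, k, false).
  split=> [r r01|y Wy].
    have [y ny yr] :=
      staircase_onto d_metric nbhs_d sibP d_complete (p n) (r0 k) r01.
    by exists y => //; apply: nW; have := r0 k; lra.
  apply: (staircase_supp d_metric sibP) => //; rewrite leNgt; apply/negP => ny.
  by apply/Wy/nW; have := r0 k; lra.
Qed.
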